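(* Let $n\ge 0$ be an integer and define \[ g(n)=\begin{cases} 3^{n/3} & \text{if } n\equiv 0 \pmod 3,\\ 4\cdot 3^{(n-4)/3} & \text{if } n\equiv 1 \pmod 3,\\ 16\cdot 3^{(n-8)/3} & \text{if } n\equiv 2 \pmod 3.\end{cases} \] If $\mathcal{H}$ is a $3$-uniform hypergraph on $n$ vertices, then the number of maximal strongly independent sets of $\mathcal{H}$ is at most $g(n)$. Moreover, for every $n\ge 6$ there is a $3$-uniform hypergraph $\mathcal{H}$ on $n$ vertices whose number of maximal strongly independent sets equals $g(n)$.
   Context: A $3$-uniform hypergraph is a finite vertex set together with a family of $3$-element subsets (hyperedges). A set $S$ of vertices is strongly independent if every hyperedge shares at most one vertex with $S$. A strongly independent set is maximal if it is not a proper subset of another strongly independent set. *)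

(* Defs.v *)
From HB Require Import structures.
From mathcomp Require Import all_boot all_order all_algebra.

Set Implicit Arguments.
Unset Strict Implicit.
Unset Printing Implicit Defensive.

Import Order.TTheory GRing.Theory Num.Theory.

Local Open Scope ring_scope.

(* A 3-uniform hypergraph is a vertex type V : finType with an edge family
   E : {set {set V}} such that uniform3 E. *)
Definition uniform3 (V : finType) (E : {set {set V}}) : bool :=
  [forall e in E, #|e| == 3%N].

Definition strongly_independent (V : finType) (E : {set {set V}})
    (S : {set V}) : bool :=
  [forall e in E, (#|e :&: S| <= 1)%N].

Definition max_strongly_independent_sets (V : finType) (E : {set {set V}}) :
    {set {set V}} :=
  [set S : {set V} | maxset (strongly_independent E) S].

(* Rational-valued, with integer exponents, because the exponent is negative
   for n = 1, 2, 5 (e.g. g 1 = 4/3); the integer divisions are all exact. *)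
Definition g (n : nat) : rat :=
  if (n %% 3)%N == 0%N then 3 ^ (n%:Z %/ 3)%Z
  else if (n %% 3)%N == 1%N then 4 * 3 ^ ((n%:Z - 4) %/ 3)%Z
  else 16 * 3 ^ ((n%:Z - 8) %/ 3)%Z.

(* Main.v *)
(** A strongly independent set is an independent set of the 2-shadow graph, in
    which every edge lies in a triangle.  A maximal independent set meets every
    closed neighbourhood N[v] and, once it contains u, restricts to a maximal
    independent set of G - N[u]; hence mis(G) is at most the sum of
    mis(G - N[u]) over u in N[v].  Taking v of minimum degree yields the
    Moon-Moser bound, which is g(n) unless n = 2 mod 3.  For n = 2 mod 3 the
    same recursion, fed with the Moon-Moser bound, gives g(n) as soon as the
    minimum degree d is not 1 or 2.  The triangle condition excludes d = 1.  If
    d = 2, either N[v] is a triangle component, which is split off by induction,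
    or some u in N[v] has degree at least 3, and the bound for G - N[u] improves
    enough.  Equality is attained by disjoint unions of complete hypergraphs on
    3 or 4 vertices. *)
Require Import Defs.
From HB Require Import structures.
From mathcomp Require Import all_boot all_order all_algebra.
From mathcomp Require Import zify.
Import Order.TTheory GRing.Theory Num.Theory.

Set Implicit Arguments.
Unset Strict Implicit.
Unset Printing Implicit Defensive.

(** * Maximal independent sets of induced subgraphs, and the branching inequality *)

Section MaximalIndependentSets.

Variables (V : finType) (e : rel V).
Hypothesis e_sym : symmetric e.
Implicit Types (A S : {set V}) (u v x y : V).

Definition closed_nbhd A u : {set V} := [set w in A | (w == u) || e u w].

Definition maximal_independent_sets A : {set {set V}} :=
  [set S : {set V} |
    [&& S \subset A, [forall x in S, forall y in S, ~~ e x y]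
      & [forall x in A, (x \in S) || [exists y in S, e x y]]]].

Local Notation mis := maximal_independent_sets.

Lemma misP A S :
  reflect [/\ S \subset A, {in S &, forall x y, ~~ e x y}
            & forall x, x \in A -> x \in S \/ exists2 y, y \in S & e x y]
          (S \in mis A).
Proof.
rewrite inE; apply: (iffP and3P) => -[sSA ind dom]; split=> //.
- by move=> x y xS yS; move/forall_inP/(_ x xS)/forall_inP: ind; apply.
- move=> x /(forall_inP dom) /orP[|/exists_inP[y]]; first by left.
  by right; exists y.
- by apply/forall_inP => x xS; apply/forall_inP => y; apply: ind.
- apply/forall_inP => x /dom[->//|[y yS exy]].
  by apply/orP; right; apply/exists_inP; exists y.
Qed.

Lemma closed_nbhd_sub A u : closed_nbhd A u \subset A.
Proof. by apply/subsetP => w; rewrite inE => /andP[]. Qed.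

Lemma closed_nbhd_refl A u : u \in A -> u \in closed_nbhd A u.
Proof. by rewrite inE eqxx => ->. Qed.

(** Deleting [u] is injective on the sets that contain it. The rest stays maximal outside the closed
    neighbourhood of [u]: a vertex there is not adjacent to [u], so whatever dominates it is another
    vertex of [S]. *)
Lemma card_mis_containing A u : u \in A ->
  #|[set S in mis A | u \in S]| <= #|mis (A :\: closed_nbhd A u)|.
Proof.
move=> uA.
have inj : {in [set S in mis A | u \in S] &, injective (fun S => S :\ u)}.
  move=> S T; rewrite !inE => /andP[_ uS] /andP[_ uT] eqST.
  by rewrite -(setD1K uS) -(setD1K uT) eqST.
rewrite -(card_in_imset inj); apply: subset_leq_card.
apply/subsetP => _ /imsetP[S + ->]; rewrite inE => /andP[/misP[sSA ind dom] uS].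
apply/misP; split.
- apply/subsetP => x; rewrite !inE => /andP[/negPf-> xS].
  by rewrite (subsetP sSA) // (negPf (ind _ _ uS xS)).
- by move=> x y /setD1P[_ xS] /setD1P[_ yS]; apply: ind.
- move=> x; rewrite !inE => /andP[+ xA]; rewrite xA negb_or => /andP[xu nux].
  case: (dom x xA) => [xS|[y yS exy]]; first by left; rewrite xu.
  right; exists y => //; rewrite !inE yS andbT.
  by apply: contraNneq nux => <-; rewrite e_sym.
Qed.

Lemma card_mis_rec A v : v \in A ->
  #|mis A| <= \sum_(u in closed_nbhd A v) #|mis (A :\: closed_nbhd A u)|.
Proof.
move=> vA.
apply: (@leq_trans (\sum_(u in closed_nbhd A v) #|[set S in mis A | u \in S]|)).
  have {1}-> : mis A =
      \bigcup_(u in closed_nbhd A v) [set S in mis A | u \in S].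
    apply/setP => S; apply/idP/bigcupP => [SA|[u _]]; last by rewrite inE => /andP[].
    have /misP[sSA _ dom] := SA.
    case: (dom v vA) => [vS|[u uS evu]].
      by exists v; rewrite ?closed_nbhd_refl // inE SA.
    by exists u; rewrite inE ?SA // (subsetP sSA) // evu orbT.
  apply: (big_ind2 (fun (B : {set {set V}}) n => #|B| <= n)) => //.
    by rewrite cards0.
  move=> B m C n Bm Cn.
  by rewrite (leq_trans (leq_card_setU _ _)) // leq_add.
by apply: leq_sum => u /(subsetP (closed_nbhd_sub A v)); apply: card_mis_containing.
Qed.

Lemma card_mis0 : #|mis set0| <= 1.
Proof.
rewrite -(cards1 (set0 : {set V})); apply: subset_leq_card.
by apply/subsetP => S /misP[+ _ _]; rewrite subset0 inE.
Qed.

Lemma card_setD_closed_nbhd A u :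
  #|A :\: closed_nbhd A u| = #|A| - #|closed_nbhd A u|.
Proof. by rewrite cardsD (setIidPr (closed_nbhd_sub A u)). Qed.

Lemma card_closed_nbhd_gt0 A u : u \in A -> 0 < #|closed_nbhd A u|.
Proof. by move=> uA; apply/card_gt0P; exists u; apply: closed_nbhd_refl. Qed.

Lemma exists_min_nbhd A : 0 < #|A| ->
  exists2 v, v \in A & forall u, u \in A -> #|closed_nbhd A v| <= #|closed_nbhd A u|.
Proof.
case/card_gt0P=> v0 v0A.
case: (@arg_minnP _ v0 (mem A) (fun u => #|closed_nbhd A u|)) => // v vA vmin.
by exists v.
Qed.

End MaximalIndependentSets.

(** * Arithmetic of the two bounds *)

(* Both bounds are multiplied by 9, which clears the denominators of g. *)
Fixpoint moon_moser9 (n : nat) : nat :=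
  match n with 0 => 9 | 1 => 12 | 2 => 18 | m.+3 => 3 * moon_moser9 m end.

Fixpoint g9 (n : nat) : nat :=
  match n with 0 => 9 | 1 => 12 | 2 => 16 | m.+3 => 3 * g9 m end.

(** Steps of three match the recursion of both bounds, so the inequalities below are merely scaled
    by 3. *)
Lemma nat_ind3 (P : nat -> Prop) :
  P 0 -> P 1 -> P 2 -> (forall n, P n -> P n.+3) -> forall n, P n.
Proof.
move=> P0 P1 P2 PS n; suff: [/\ P n, P n.+1 & P n.+2] by case.
by elim: n => // n [? ? ?]; split; auto.
Qed.

Lemma moon_moser9_mono : {homo moon_moser9 : m n / m <= n}.
Proof.
apply: homo_leq => [//|m n p|n]; first exact: leq_trans.
by elim/nat_ind3: n => // n /=; lia.
Qed.

Lemma moon_moser9_mul j m : j * moon_moser9 m <= moon_moser9 (m + j).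
Proof.
elim/nat_ind3: m => [|||m IH]; last by rewrite addSn /= mulnCA leq_mul2l IH.
(* From [j = 2] on, [j + 3 <= 3 * j], so raising [j] by 3 at most triples the left side; 0 and 1 are
   checked apart. *)
all: by case: j => [|[|j]] //; elim/nat_ind3: j => // j /=; lia.
Qed.

(** Here [j] is the minimum size of a closed neighbourhood. In residue 2 the inequality is tight for
    [j = 4] and fails for [j = 2] and [j = 3], for instance [2 * 9 > 16] and [3 * 18 > 48]; those
    are the degrees 1 and 2 that need the triangles. *)
Lemma g9_mul j m : 3 < j -> (m + j) %% 3 = 2 ->
  j * moon_moser9 m <= g9 (m + j).
Proof.
case: j => [|[|[|[|j]]]] // _.
elim/nat_ind3: m => [|||m IH]; last first.
  rewrite !addSn /= => eq2; rewrite mulnCA leq_mul2l IH //; lia.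
all: elim/nat_ind3: j => // j IH; move: IH => /=; lia.
Qed.

Lemma g9_one m : m %% 3 = 1 -> moon_moser9 m <= g9 m.+1.
Proof. by elim/nat_ind3: m => // m IH; move: IH => /=; lia. Qed.

(** Three branches, two losing 3 vertices and one losing 4. This is tight: [2 * 18 + 12 = 48] for
    [m = 1]. *)
Lemma g9_three m : m %% 3 = 1 ->
  2 * moon_moser9 m.+1 + moon_moser9 m <= g9 m.+4.
Proof. by elim/nat_ind3: m => // m IH; move: IH => /=; lia. Qed.

Lemma moon_moser9_le_g9 n : n %% 3 != 2 -> moon_moser9 n <= g9 n.
Proof. by elim/nat_ind3: n => // n IH /=; lia. Qed.

(** * Upper bounds for graphs, without and with the triangle condition *)

Section UpperBound.

Variables (V : finType) (e : rel V).
Hypotheses (e_sym : symmetric e) (e_irr : irreflexive e).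
Implicit Types (A : {set V}) (u v : V).

Local Notation mis := (maximal_independent_sets e).
Local Notation N := (closed_nbhd e).

Theorem moon_moser A : 9 * #|mis A| <= moon_moser9 #|A|.
Proof.
have [n] := ubnP #|A|; elim: n A => // n IH A ltAn.
have [A0|Agt0] := posnP #|A|.
  by rewrite A0 (cards0_eq A0) -[leqRHS]/(9 * 1) leq_mul2l card_mis0.
have [v vA vmin] := exists_min_nbhd e Agt0.
have NA u : #|N A u| <= #|A| by rewrite subset_leq_card ?closed_nbhd_sub.
apply: (@leq_trans (\sum_(u in N A v) moon_moser9 (#|A| - #|N A v|))).
  apply: leq_trans (leq_mul (leqnn 9) (card_mis_rec e_sym vA)) _.
  rewrite big_distrr /=; apply: leq_sum => u uN.
  have uA := subsetP (closed_nbhd_sub e A v) _ uN.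
  have N0 := card_closed_nbhd_gt0 e uA.
  apply: leq_trans (IH _ _) _; rewrite card_setD_closed_nbhd.
    by have := NA u; lia.
  by apply: moon_moser9_mono; have := vmin _ uA; lia.
rewrite sum_nat_const; apply: leq_trans (moon_moser9_mul _ _) _.
by rewrite subnK.
Qed.

(** The third vertex must lie in [A], so deleting a closed neighbourhood may destroy the condition;
    branches are therefore bounded by [moon_moser] unless a whole component is removed. *)
Definition edges_in_triangles A :=
  {in A &, forall x y, e x y -> exists2 z, z \in A & e x z && e y z}.

(** A neighbour of [v] and the third vertex of a triangle on that edge are two distinct
    neighbours. *)
Lemma card_closed_nbhd_triangle A v : edges_in_triangles A -> v \in A ->
  1 < #|N A v| -> 2 < #|N A v|.
Proof.
move=> tri vA.
rewrite (cardsD1 v) closed_nbhd_refl // ltnS => /card_gt0P[x].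
rewrite !inE => /and3P[xv xA]; rewrite (negPf xv) /= => evx.
have [z zA /andP[evz exz]] := tri _ _ vA xA evx.
have zv : z != v by apply: contraTneq evz => ->; rewrite e_irr.
have zx : z != x by apply: contraTneq exz => ->; rewrite e_irr.
rewrite (cardsD1 x) (cardsD1 z) !inE xv xA evx zv zx zA evz !orbT /=; lia.
Qed.

(** For a neighbour [u] of [v], a triangle on the edge already fills the closed neighbourhood of
    [v]. It also lies in that of [u], which has no room for more. *)
Lemma closed_nbhd_triangle_component A v : edges_in_triangles A -> v \in A ->
  #|N A v| = 3 -> {in N A v, forall u, #|N A u| <= 3} ->
  {in N A v, forall u, N A u = N A v}.
Proof.
move=> tri vA N3 Nle u uN; apply/esym/eqP; rewrite eqEcard N3 Nle // andbT.
have uA := subsetP (closed_nbhd_sub e A v) _ uN.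
move: (uN); rewrite inE uA /=; have [-> //|uv /= evu] := eqVneq u v.
have [z zA /andP[evz euz]] := tri _ _ vA uA evu.
have zv : z != v by apply: contraTneq evz => ->; rewrite e_irr.
have zu : z != u by apply: contraTneq euz => ->; rewrite e_irr.
have <- : [set v; u; z] = N A v.
  apply/eqP; rewrite eqEcard N3; apply/andP; split; last first.
    by rewrite setUC cardsU1 cards2 !inE negb_or zv zu eq_sym uv.
  apply/subsetP => w; rewrite !inE => /orP[/orP[]|] /eqP->;
    by rewrite ?vA ?uA ?zA ?eqxx ?evu ?evz ?orbT.
apply/subsetP => w; rewrite !inE => /orP[/orP[]|] /eqP->.
- by rewrite vA e_sym evu orbT.
- by rewrite uA eqxx.
- by rewrite zA euz orbT.
Qed.

(** If the third vertex [z] were deleted, its neighbour [x] would lie in the closed neighbourhood of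
    [z], which is that of [v], and would be deleted too. *)
Lemma edges_in_trianglesD A v : edges_in_triangles A ->
  {in N A v, forall u, N A u = N A v} -> edges_in_triangles (A :\: N A v).
Proof.
move=> tri comp x y /setDP[xA xN] /setDP[yA _] exy.
have [z zA /andP[exz eyz]] := tri _ _ xA yA exy; exists z; last by rewrite exz.
rewrite in_setD zA andbT; apply: contra xN => zN.
by rewrite -(comp _ zN) inE xA e_sym exz orbT.
Qed.

Theorem card_mis_edges_in_triangles A : edges_in_triangles A ->
  9 * #|mis A| <= g9 #|A|.
Proof.
have [n] := ubnP #|A|; elim: n A => // n IH A ltAn tri.
have [A2|A2] := eqVneq (#|A| %% 3) 2; last first.
  exact: leq_trans (moon_moser A) (moon_moser9_le_g9 A2).
have Agt0 : 0 < #|A| by case: posnP A2 => // ->.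
have [v vA vmin] := exists_min_nbhd e Agt0.
have NA u : #|N A u| <= #|A| by rewrite subset_leq_card ?closed_nbhd_sub.
have rec := leq_mul (leqnn 9) (card_mis_rec e_sym vA).
have sumle : \sum_(u in N A v) 9 * #|mis (A :\: N A u)| <=
             #|N A v| * moon_moser9 (#|A| - #|N A v|).
  rewrite -sum_nat_const; apply: leq_sum => u uN.
  apply: leq_trans (moon_moser _) _; rewrite card_setD_closed_nbhd.
  by apply/moon_moser9_mono/leq_sub2l/vmin/(subsetP (closed_nbhd_sub e A v)).
rewrite big_distrr /= in rec; apply: leq_trans rec _.
have := card_closed_nbhd_triangle tri vA.
have := card_closed_nbhd_gt0 e vA.
have [N4 _ _|N3 N0 N12] := ltnP 3 #|N A v|.
  apply: leq_trans sumle _; rewrite -[in leqRHS](subnK (NA v)).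
  by apply: g9_mul; rewrite ?subnK.
have [N1|N1] := eqVneq #|N A v| 1.
  apply: leq_trans sumle _; rewrite N1 mul1n.
  by rewrite -[in leqRHS](subnK Agt0) addn1; apply: g9_one; lia.
have {N0 N1 N12 N3}N3 : #|N A v| = 3 by lia.
have [/forall_inP Nle|] := boolP [forall u in N A v, #|N A u| <= 3].
  have comp := closed_nbhd_triangle_component tri vA N3 Nle.
  under eq_bigr => u uN do rewrite comp //.
  rewrite sum_nat_const N3.
  (* All three branches delete the same triangle, so the induction hypothesis applies to the one
     remaining graph. *)
  have cardD : #|A| = #|A :\: N A v|.+3.
    by rewrite card_setD_closed_nbhd; have := NA v; lia.
  rewrite cardD /= leq_mul2l IH //; first by lia.
  exact: edges_in_trianglesD.
rewrite negb_forall_in => /exists_inP[u uN]; rewrite -ltnNge => N4.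
(* The branch of [u] loses at least 4 vertices; the other two lose at least 3 by minimality of
   [v]. *)
rewrite (bigD1 u) //=.
have NAu := NA u.
have -> : #|A| = (#|A| - 4).+4 by lia.
apply: leq_trans _ (g9_three _); last by lia.
rewrite addnC leq_add //; last first.
  apply: leq_trans (moon_moser _) _; rewrite card_setD_closed_nbhd.
  by apply: moon_moser9_mono; lia.
apply: (@leq_trans (\sum_(w in N A v | w != u) moon_moser9 (#|A| - 4).+1)).
  apply: leq_sum => w /andP[wN _].
  apply: leq_trans (moon_moser _) _; rewrite card_setD_closed_nbhd.
  have := vmin _ (subsetP (closed_nbhd_sub e A v) _ wN).
  by move=> ?; apply: moon_moser9_mono; lia.
have <- : #|N A v :\ u| = 2 by have := cardsD1 u (N A v); rewrite uN N3; lia.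
rewrite -sum_nat_const; apply/eq_leq/eq_bigl => w.
by rewrite !inE andbC.
Qed.

End UpperBound.

(** * From hypergraphs to their 2-shadow graphs *)

Section Shadow.

Variables (V : finType) (E : {set {set V}}).

Definition shadow : rel V :=
  fun x y => (x != y) && [exists a in E, (x \in a) && (y \in a)].

Lemma shadow_sym : symmetric shadow.
Proof.
move=> x y; rewrite /shadow eq_sym; congr andb; apply: eq_existsb => a.
by rewrite [(x \in a) && _]andbC.
Qed.

Lemma shadow_irr : irreflexive shadow.
Proof. by move=> x; rewrite /shadow eqxx. Qed.

Lemma strongly_independentP (S : {set V}) :
  reflect {in S &, forall x y, ~~ shadow x y} (strongly_independent E S).
Proof.
apply: (iffP forall_inP) => [ind x y xS yS|ind a aE].
  apply/negP => /andP[xy /exists_inP[a aE /andP[xa ya]]].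
  move: (ind a aE); rewrite leqNgt => /card_gt1P[].
  by exists x, y; rewrite !inE xa ya xS yS.
rewrite leqNgt; apply/card_gt1P => -[x [y []]]; rewrite !inE.
move=> /andP[xa xS] /andP[ya yS] xy.
case/negP: (ind _ _ xS yS); rewrite /shadow xy.
by apply/exists_inP; exists a; rewrite ?xa.
Qed.

Lemma max_strongly_independent_setsE :
  max_strongly_independent_sets E = maximal_independent_sets shadow setT.
Proof.
apply/setP => S; rewrite inE; apply/maxsetP/misP.
  move=> [/strongly_independentP ind max].
  split=> [|//|x _]; first exact: subsetT.
  have [xS|xS] := boolP (x \in S); [by left | right].
  have [/exists_inP //|] := boolP [exists y in S, shadow x y].
  rewrite negb_exists_in => /forall_inP noS.
  (* An undominated [x] could be added to [S], against maximality. *)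
  suff si : strongly_independent E (x |: S).
    by move: xS; rewrite -(max _ si (subsetUr _ _)) setU11.
  apply/strongly_independentP => y z.
  case/setU1P=> [->|yS] /setU1P[->|zS]; rewrite ?shadow_irr ?noS //.
    by rewrite shadow_sym noS.
  exact: ind.
move=> [_ ind dom]; split=> [|T /strongly_independentP indT sST]; first exact/strongly_independentP.
apply/eqP; rewrite eqEsubset sST andbT; apply/subsetP => x xT.
case: (dom x (in_setT x)) => // -[y yS exy].
by case/negP: (indT _ _ xT (subsetP sST _ yS)).
Qed.

Lemma shadow_edges_in_triangles : uniform3 E -> edges_in_triangles shadow setT.
Proof.
move=> /forall_inP u3 x y _ _ /andP[xy /exists_inP[a aE /andP[xa ya]]].
have : 0 < #|(a :\ x) :\ y|.
  have := eqP (u3 a aE); rewrite (cardsD1 x) (cardsD1 y (a :\ x)) xa.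
  by rewrite !inE eq_sym xy ya; lia.
case/card_gt0P=> z; rewrite !inE => /and3P[zy zx za]; exists z => //.
rewrite /shadow ![_ == z]eq_sym zx zy /=.
by apply/andP; split; apply/exists_inP; exists a; rewrite ?xa ?ya.
Qed.

End Shadow.

(** * Extremal hypergraphs *)

Definition realizable (n m : nat) : Prop :=
  exists (V : finType) (E : {set {set V}}),
    [/\ #|V| = n, uniform3 E & #|max_strongly_independent_sets E| = m].

(** With at least three vertices, any two share a hyperedge. The shadow is then a complete graph,
    whose maximal independent sets are the singletons. *)
Lemma realizable_complete n : 2 < n -> realizable n n.
Proof.
move=> n2; exists 'I_n, [set a : {set 'I_n} | #|a| == 3].
split; [exact: card_ord | by apply/forall_inP => a; rewrite inE |].
have shE x y : shadow [set a : {set 'I_n} | #|a| == 3] x y = (x != y).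
  rewrite /shadow; case: eqVneq => //= xy.
  have : 0 < #|~: [set x; y]|.
    by have := cardsC [set x; y]; rewrite cards2 xy card_ord; lia.
  case/card_gt0P=> z; rewrite !inE negb_or => /andP[zx zy].
  apply/exists_inP; exists (z |: [set x; y]).
    by rewrite inE cardsU1 cards2 xy !inE negb_or zx zy.
  by rewrite !inE !eqxx !orbT.
rewrite max_strongly_independent_setsE -[RHS]card_ord -[RHS](card_imset _ set1_inj).
apply: eq_card => S; apply/misP/imsetP => [[_ ind dom]|[x _ ->]].
  have [x xS] : exists x, x \in S.
    have x0 : 'I_n by exact: (Ordinal (ltnW (ltnW n2))).
    by case: (dom x0 (in_setT _)) => [|[y yS _]]; [exists x0 | exists y].
  exists x => //; apply/setP => y; rewrite inE; apply/idP/eqP => [yS|->//].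
  by apply/eqP; have := ind _ _ yS xS; rewrite shE negbK.
split=> [|y z /set1P-> /set1P->|y _]; [exact: subsetT | by rewrite shE eqxx |].
have [->|yx] := eqVneq y x; first by left; rewrite set11.
by right; exists x; rewrite ?set11 // shE.
Qed.

(** The shadow has no edge between the two sides, so independence and domination are decided on each
    side separately. *)
Lemma realizable_disjoint_union n1 m1 n2 m2 :
  realizable n1 m1 -> realizable n2 m2 -> realizable (n1 + n2) (m1 * m2).
Proof.
move=> [V1 [E1 [cV1 u1 c1]]] [V2 [E2 [cV2 u2 c2]]].
pose l (S : {set V1}) : {set V1 + V2} := inl @: S.
pose r (S : {set V2}) : {set V1 + V2} := inr @: S.
have inl_inj : injective (@inl V1 V2) by move=> x y [].
have inr_inj : injective (@inr V1 V2) by move=> x y [].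
have inll S x : (inl x \in l S) = (x \in S) by rewrite mem_imset.
have inrr S x : (inr x \in r S) = (x \in S) by rewrite mem_imset.
have inlr S x : (inl x \in r S) = false by apply/imsetP => -[].
have inrl S x : (inr x \in l S) = false by apply/imsetP => -[].
pose E := l @: E1 :|: r @: E2.
exists (V1 + V2)%type, E; split; first by rewrite card_sum cV1 cV2.
  apply/forall_inP => a /setUP[] /imsetP[b bE ->]; rewrite card_imset //.
    exact: (forall_inP u1).
  exact: (forall_inP u2).
have sll x y : shadow E (inl x) (inl y) = shadow E1 x y.
  rewrite /shadow (inj_eq inl_inj); congr andb.
  apply/exists_inP/exists_inP => [[a /setUP[]/imsetP[b bE ->]]|[b bE xyb]].
  - by rewrite !inll; exists b.
  - by rewrite !inlr.
  - by exists (l b); rewrite ?inll // inE imset_f.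
have srr x y : shadow E (inr x) (inr y) = shadow E2 x y.
  rewrite /shadow (inj_eq inr_inj); congr andb.
  apply/exists_inP/exists_inP => [[a /setUP[]/imsetP[b bE ->]]|[b bE xyb]].
  - by rewrite !inrl.
  - by rewrite !inrr; exists b.
  - by exists (r b); rewrite ?inrr // inE imset_f ?orbT.
have slr x y : shadow E (inl x) (inr y) = false.
  apply/negbTE/andP => -[_ /exists_inP[a /setUP[]/imsetP[b bE ->]]].
    by rewrite inrl andbF.
  by rewrite inlr.
have srl x y : shadow E (inr x) (inl y) = false by rewrite shadow_sym slr.
pose f (p : {set V1} * {set V2}) := l p.1 :|: r p.2.
have finl p x : (inl x \in f p) = (x \in p.1) by rewrite inE inll inlr orbF.
have finr p x : (inr x \in f p) = (x \in p.2) by rewrite inE inrr inrl.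
have f_inj : injective f.
  move=> [A B] [C D] /setP eqf; congr pair; apply/setP => x.
    by have := eqf (inl x); rewrite !finl.
  by have := eqf (inr x); rewrite !finr.
rewrite -c1 -c2 -cardsX -[RHS](card_imset _ f_inj) !max_strongly_independent_setsE.
apply: eq_card => S; apply/misP/imsetP => [[_ ind dom]|[[A B]]].
  exists (inl @^-1: S, inr @^-1: S); last first.
    by apply/setP => -[] x; rewrite ?finl ?finr inE.
  rewrite inE /=; apply/andP; split; apply/misP; split.
  - exact: subsetT.
  - by move=> x y; rewrite !inE -sll; apply: ind.
  - move=> x _; rewrite inE; case: (dom (inl x) (in_setT _)) => [|[[] y yS]].
      by left.
      by rewrite sll => exy; right; exists y; rewrite ?inE.
    by rewrite slr.
  - exact: subsetT.
  - by move=> x y; rewrite !inE -srr; apply: ind.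
  - move=> x _; rewrite inE; case: (dom (inr x) (in_setT _)) => [|[[] y yS]].
      by left.
      by rewrite srl.
    by rewrite srr => exy; right; exists y; rewrite ?inE.
rewrite inE /= => /andP[/misP[_ indA domA] /misP[_ indB domB]] ->; split.
- exact: subsetT.
- by case=> x [] y; rewrite ?finl ?finr ?sll ?srr ?slr ?srl //=;
    [apply: indA | apply: indB].
- case=> x _; rewrite ?finl ?finr /=.
    case: (domA x (in_setT _)) => [|[y yA exy]]; [by left | right].
    by exists (inl y); rewrite ?finl ?sll.
  case: (domB x (in_setT _)) => [|[y yB exy]]; [by left | right].
  by exists (inr y); rewrite ?finr ?srr.
Qed.

(** The sizes [3 + 3], [4 + 3] and [4 + 4] start the three residues; each further block of 3
    vertices triples the count. *)
Lemma realizable_g9 n : 6 <= n -> exists2 m, realizable n m & 9 * m = g9 n.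
Proof.
move=> /subnK <-; elim/nat_ind3: (n - 6) => [|||k [m rm eqm]].
- exists (3 * 3) => //.
  by apply: (@realizable_disjoint_union 3 _ 3); apply: realizable_complete.
- exists (4 * 3) => //.
  by apply: (@realizable_disjoint_union 4 _ 3); apply: realizable_complete.
- exists (4 * 4) => //.
  by apply: (@realizable_disjoint_union 4 _ 4); apply: realizable_complete.
- exists (3 * m); last by rewrite mulnCA eqm.
  by apply: (@realizable_disjoint_union 3 3) rm; apply: realizable_complete.
Qed.

(** * Transfer to the rational bound [g] *)

Local Open Scope ring_scope.

Lemma gE n : 9 * g n = (g9 n)%:R.
Proof.
elim/nat_ind3: n => // n IH.
have -> : g n.+3 = 3 * g n; last by rewrite mulrCA IH -natrM.
have mod3 : (n.+3 %% 3)%N = (n %% 3)%N by lia.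
(* Stated over [int], this also covers the negative exponents of small [n]. *)
have step (z : int) : 3 ^ ((z + 3) %/ 3)%Z = 3 * 3 ^ (z %/ 3)%Z :> rat.
  by rewrite divzDr // divzz /= expfzDr // expr1z mulrC.
have n3 : n.+3%:Z = n%:Z + 3 by lia.
by rewrite /g mod3 n3 ![_ + 3 - _]addrAC !step; do 2?case: ifP => _ //;
  rewrite mulrCA.
Qed.

Theorem theorem2 (n : nat) :
  (forall (V : finType) (E : {set {set V}}),
     #|V| = n -> uniform3 E ->
     #|max_strongly_independent_sets E|%:R <= g n)
  /\
  ((6 <= n)%N ->
     exists (V : finType) (E : {set {set V}}),
       [/\ #|V| = n, uniform3 E &
           #|max_strongly_independent_sets E|%:R = g n]).
Proof.
have nine : 0 < 9 :> rat by [].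
split=> [V E cV u3|n6].
  rewrite -(ler_pM2l nine) gE -natrM ler_nat -cV -cardsT.
  rewrite max_strongly_independent_setsE; apply: card_mis_edges_in_triangles.
  - exact: shadow_sym.
  - exact: shadow_irr.
  - exact: shadow_edges_in_triangles.
have [m [V [E [cV u3 cm]]] eqm] := realizable_g9 n6.
exists V, E; split=> //; apply: (mulfI (lt0r_neq0 nine)).
by rewrite gE cm -natrM eqm.
Qed.
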